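(* Let $L\colon\mathbb{F}_{2^n}\to\mathbb{F}_{2^n}$ be $\mathbb{F}_2$-linear and let $G\colon\mathbb{F}_{2^n}\to\mathbb{F}_{2^n}$ be defined by $G(x)=x^3+\mathrm{Tr}(x)L(x)$. Then $G$ is APN if and only if $$\sum_{x\in\mathbb{F}_{2^n}\setminus\{0,1\}}(-1)^{\mathrm{Tr}\left(\frac{x^2L(x^2+x)}{(x^2+x)^3}\right)}-\frac{1}{2}\sum_{x\in\mathbb{F}_{2^n}\setminus\{0,1\}}(-1)^{\mathrm{Tr}\left(\frac{L(x^2+x)}{(x^2+x)^3}\right)}=2^{n-1}-1.$$
   Context: $\mathrm{Tr}$ is the absolute trace $\mathbb{F}_{2^n}\to\mathbb{F}_2$. $G$ is APN if for every nonzero $a$ and every $b$ in $\mathbb{F}_{2^n}$ the equation $G(x+a)+G(x)=b$ has at most $2$ solutions $x\in\mathbb{F}_{2^n}$. *)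

(* Defs.v *)
From HB Require Import structures.
From mathcomp Require Import all_boot all_order all_algebra all_fingroup all_solvable all_field.

Set Implicit Arguments.
Unset Strict Implicit.
Unset Printing Implicit Defensive.

Import GRing.Theory Num.Theory.
Local Open Scope ring_scope.

Definition APN (F : finFieldType) (G : F -> F) : Prop :=
  forall a b : F, a != 0 -> (#|[set x : F | (G (x + a) + G x == b)%R]| <= 2)%N.

(* [pPrimeCharType charF] is F itself, equipped with its structure of extension
   of 'F_2.  The Galois trace lies in the prime subfield 1%VS (see trE below),
   and its coordinate on the basis (1) is the corresponding element of 'F_2. *)
Definition tr (F : finFieldType) (charF : 2%N \in [pchar F])
    (x : pPrimeCharType charF) : 'F_2 :=
  coord [tuple (1 : pPrimeCharType charF)] 0 (galTrace 1 {:pPrimeCharType charF} x).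

Section Trace.

Variables (F : finFieldType) (charF : 2%N \in [pchar F]).
Local Notation K := (pPrimeCharType charF).

Lemma trE (x : K) : (tr x)%:A = galTrace 1 {:K} x.
Proof.
have galK : galois 1 {:K} by exact: finField_galois (sub1v _).
have := mem_galTrace galK (memvf x); case/vlineP=> k Dk.
rewrite /tr Dk linearZ /= (coord_free 0 0) ?mulr1 //.
by rewrite seq1_free oner_eq0.
Qed.

Lemma galTrace_pow n (cardF : #|F| = (2 ^ n)%N) (x : K) :
  galTrace 1 {:K} x = \sum_(i < n) x ^+ (2 ^ i).
Proof.
have [alpha] := finField_galois_generator (sub1v {:K}).
rewrite dimv1 expn1 card_Fp // => /eqP defG Dalpha.
have Dai i (y : K) : (alpha ^+ i)%g y = y ^+ (2 ^ i).
  elim: i y => [|i IHi] y; first by rewrite gal_id expr1.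
  by rewrite expgSr galM ?memvf // IHi Dalpha ?memvf // -exprM -expnSr.
have oa : #[alpha]%g = n.
  rewrite orderE -defG -galois_dim ?finField_galois ?sub1v // dimv1 divn1.
  by rewrite pprimeChar_dimf cardF pfactorK.
have cycE : <[alpha]>%g = [set (alpha ^+ nat_of_ord i)%g | i : 'I_n].
  apply/setP=> b; apply/idP/imsetP=> [/cyclePmin[i lti ->] | [i _ ->]].
    by rewrite oa in lti; exists (Ordinal lti).
  exact: mem_cycle.
rewrite /galTrace defG cycE big_imset /= => [|i j _ _ /eqP].
  by apply: eq_bigr => i _; rewrite Dai.
by rewrite eq_expg_mod_order oa !modn_small // => /eqP/val_inj.
Qed.

End Trace.

(* Main.v *)
(* G is APN iff, for u <> 0, the alternating form uv^2 + u^2v + Tr(v)L(u) + Tr(u)L(v)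
   vanishes only at v = 0, u.  Choosing a basis of <u, v> one may take Tr(u) = 0
   (so u = x^2 + x) and Tr(v) = 1; then v = uw with w^2 + w = L(u)/u^3 and
   Tr(uw) = Tr(x^2 L(u)/u^3).  Hence G is APN iff Tr(L(u)/u^3) = 0 implies
   Tr(x^2 L(u)/u^3) = 0 for all x other than 0, 1.  Write A(x), B(x) for the signs in the
   two sums.  Since A(x + 1) = A(x) B(x), the left-hand side is the sum of the terms
   (A + AB - B)/2, each at most 1/2, with equality iff B = 1 implies A = 1. *)

Require Import Defs.
From mathcomp Require Import all_boot all_order all_algebra all_fingroup all_solvable all_field.
From mathcomp Require Import ring lra.

Import GRing.Theory Num.Theory.
Local Open Scope ring_scope.

Lemma F2_cases (k : 'F_2) : k = 0 \/ k = 1.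
Proof. by case: k => [[|[|k]] ?] //; [left | right]; apply/val_inj. Qed.

(** * The absolute trace and the Artin-Schreier map *)

Section Trace.

Variables (F : finFieldType) (charF : 2%N \in [pchar F]).
Variables (n : nat) (cardF : #|F| = (2 ^ n)%N).
Local Notation K := (pPrimeCharType charF).

Lemma pPrimeChar_pchar2 : 2%N \in [pchar K].
Proof. exact: charF. Qed.

(* Reduces a characteristic 2 identity to one valid in every commutative ring,
   z being half of the difference of the two sides over the integers. *)
Lemma eq_pchar2 (z x y : K) : x = y + (z + z) -> x = y.
Proof. by rewrite (addrr_pchar2 pPrimeChar_pchar2) addr0. Qed.

Lemma addr_eq0_pchar2 (x y : K) : x + y = 0 -> y = x.
Proof. by move/eqP; rewrite addr_eq0 (oppr_pchar2 pPrimeChar_pchar2) => /eqP. Qed.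

Lemma tr0 : tr (0 : K) = 0.
Proof. by rewrite /tr raddf0 linear0. Qed.

Lemma trD (x y : K) : tr (x + y) = tr x + tr y.
Proof. by rewrite /tr raddfD linearD. Qed.

(** Since the Frobenius map is additive, the trace of [x ^+ 2] is the square of the trace of [x],
    and squaring fixes the prime field. *)
Lemma tr_sqr (x : K) : tr (x ^+ 2) = tr x.
Proof.
apply: (fmorph_inj (in_alg K)); rewrite /= !trE !(galTrace_pow cardF).
transitivity ((\sum_(i < n) x ^+ (2 ^ i)) ^+ 2).
  rewrite -[RHS](pFrobenius_autE pPrimeChar_pchar2) rmorph_sum; apply: eq_bigr => i _.
  by rewrite exprAC -[LHS](pFrobenius_autE pPrimeChar_pchar2).
rewrite -(galTrace_pow cardF) -trE.
by case: (F2_cases (tr x)) => ->; rewrite ?scale0r ?scale1r ?expr0n ?expr1n.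
Qed.

Lemma tr_artin_schreier (x : K) : tr (x ^+ 2 + x) = 0.
Proof. by rewrite trD tr_sqr (addrr_pchar2 (pchar_Fp _)). Qed.

(** Elements of trace zero are roots of the sum of the ['X^(2 ^ i)] for [i < n], a polynomial of
    degree [2 ^ n.-1]. *)
Lemma card_tr_eq0 :
  (#|[set x : K | tr x == 0%R]| <= 2 ^ n.-1)%N.
Proof.
case: n cardF => [|m] cardF'; first by have := finNzRing_gt1 F; rewrite cardF'.
pose p : {poly K} := \sum_(i < m.+1) 'X^(2 ^ i).
have sz_p : size p = (2 ^ m).+1.
  rewrite /p big_ord_recr /= addrC size_polyDl size_polyXn // ltnS.
  apply: leq_trans (size_sum _ _ _) _; apply/bigmax_leqP => i _.
  by rewrite size_polyXn ltn_exp2l.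
rewrite cardE -ltnS -sz_p max_poly_roots ?enum_uniq //.
  by rewrite -size_poly_eq0 sz_p.
apply/allP => x; rewrite mem_enum inE => /eqP tr_x.
rewrite rootE horner_sum; apply/eqP; under eq_bigr do rewrite hornerXn.
by rewrite -(galTrace_pow cardF') -trE tr_x scale0r.
Qed.

Lemma artin_schreier_eq (x y : K) : (x ^+ 2 + x == y ^+ 2 + y) = (x == y) || (x == y + 1).
Proof.
rewrite -subr_eq0 -[x == y]subr_eq0 -[x == y + 1]subr_eq0 -mulf_eq0.
by congr (_ == 0); apply: (eq_pchar2 (x * y - y ^+ 2 + x - y)); ring.
Qed.

(** Additive Hilbert 90, by counting: the fibres of [f] have at most two elements, so its image has
    at least [2 ^ n.-1]. The image lies in the kernel of the trace, which is no larger. *)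
Lemma tr_eq0_artin_schreier (x : K) : tr x = 0 -> exists y, x = y ^+ 2 + y.
Proof.
move=> tr_x; pose f (y : K) := y ^+ 2 + y.
pose Z := [set x : K | tr x == 0].
have sSZ : f @: [set: K] \subset Z.
  by apply/subsetP => _ /imsetP[y _ ->]; rewrite inE tr_artin_schreier.
have cardS : (2 ^ n.-1 <= #|f @: [set: K]|)%N.
  have n_gt0 : (0 < n)%N.
    by case: n cardF (finNzRing_gt1 F) => // ->.
  rewrite -(leq_pmul2r (ltn0Sn 1)) -expnSr prednK // -cardF -[#|F|]/#|K| -cardsT.
  rewrite -sum1_card (partition_big_imset f) /= -sum_nat_const.
  apply: leq_sum => _ /imsetP[y _ ->].
  rewrite sum1_card.
  apply: (@leq_trans #|[set y; y + 1]|); last by rewrite cards2; case: eqP.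
  by apply/subset_leq_card/subsetP => z /andP[_]; rewrite !inE /f artin_schreier_eq.
have /eqP eqSZ : f @: [set: K] == Z.
  by rewrite eqEcard sSZ (leq_trans card_tr_eq0).
have : x \in Z by rewrite inE tr_x.
by rewrite -eqSZ => /imsetP[y _ ->]; exists y.
Qed.

(** * Zeros of the polarized form *)

Section Derivative.

Variable L : {linear K -> K}.

(* The polarization of G: G (x + u) + G x takes the same value at x and x + v
   iff dform u v = 0. *)
Definition dform (u v : K) : K :=
  u * v ^+ 2 + u ^+ 2 * v + (tr v)%:A * L u + (tr u)%:A * L v.

Lemma dformC u v : dform u v = dform v u.
Proof. by rewrite /dform; ring. Qed.

Lemma dformDl u v : dform (u + v) v = dform u v.
Proof.
rewrite /dform trD linearD scalerDl.
by apply: (eq_pchar2 (v ^+ 3 + u * v ^+ 2 + (tr v)%:A * L v)); ring.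
Qed.

Lemma dformE (G : K -> K) (defG : forall x, G x = x ^+ 3 + tr x *: L x) (a x z : K) :
  (G (z + a) + G z == G (x + a) + G x) = (dform a (z + x) == 0).
Proof.
have GE y : G y = y ^+ 3 + (tr y)%:A * L y by rewrite defG mulr_algl.
rewrite -subr_eq0; congr (_ == 0); rewrite /dform !GE !trD !(linearD L) !scalerDl.
set t := (tr x)%:A; set r := (tr z)%:A; set s := (tr a)%:A.
apply: (eq_pchar2 (z ^+ 2 * a + z * a ^+ 2 + z ^+ 3 + r * L z - x ^+ 3 - 2 * x ^+ 2 * a
  - 2 * x * a ^+ 2 - t * L x - t * L a - s * L x - a * x * z)).
ring.
Qed.

(** If [x] is one solution for [a] and [b], the solutions are the [x + v] with [v] a zero of
    [dform a]; both [0] and [a] are always such zeros. *)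
Lemma APN_dform (G : K -> K) (defG : forall x, G x = x ^+ 3 + tr x *: L x) :
  APN G <-> (forall u v : K, u != 0 -> dform u v = 0 -> v = 0 \/ v = u).
Proof.
have dform0 a : dform a 0 = 0.
  by rewrite /dform tr0 linear0 scale0r; ring.
have dformaa a : dform a a = 0.
  by rewrite -[a in dform a _](add0r a) dformDl dformC dform0.
split=> [apnG u v u_neq0 /eqP uv0 | inj a b a_neq0].
  case: (v =P 0) => [-> | /eqP v_neq0]; first by left.
  case: (v =P u) => [-> | /eqP v_neq_u]; first by right.
  have := apnG u (G (0 + u) + G 0) u_neq0; rewrite leqNgt => /negP[].
  apply: (@leq_trans #|[set 0; u; v]|).
    rewrite -setUA cardsU1 cards2 !inE ![0 == _]eq_sym [u == v]eq_sym.
    by rewrite (negPf u_neq0) (negPf v_neq0) (negPf v_neq_u).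
  apply/subset_leq_card/subsetP => z; rewrite !inE (dformE _ defG) addr0 -orbA.
  by case/or3P => /eqP->; rewrite ?dform0 ?dformaa ?uv0.
have [-> | [x]] := set_0Vmem [set x | G (x + a) + G x == b]; first by rewrite cards0.
rewrite inE => /eqP <-.
apply: (@leq_trans #|[set x; x + a]|); last by rewrite cards2; case: eqP.
apply/subset_leq_card/subsetP => z; rewrite !inE (dformE _ defG) => /eqP/(inj _ _ a_neq0).
have zE : z = x + (z + x) by apply: (eq_pchar2 (- x)); ring.
by case=> e; rewrite zE e ?addr0 eqxx ?orbT.
Qed.

Lemma dform_root (u v : K) : u != 0 -> tr u = 0 -> tr v = 1 ->
  (dform u v == 0) = (L u / u ^+ 3 == (v / u) ^+ 2 + v / u).
Proof.
move=> u_neq0 tr_u tr_v; rewrite /dform tr_u tr_v scale0r scale1r.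
rewrite -[RHS]subr_eq0 -[RHS](inj_eq (mulfI (expf_neq0 3 u_neq0))) mulr0.
by congr (_ == 0); apply: (eq_pchar2 (u * v ^+ 2 + u ^+ 2 * v)); field.
Qed.

(* For tr (L u / u ^+ 3) = 0, the trace of the putative zero v = u * w of
   dform u is thus independent of w: it is tr (x ^+ 2 * L u / u ^+ 3). *)
Lemma tr_artin_schreierM (x w : K) :
  tr (x ^+ 2 * (w ^+ 2 + w)) = tr ((x ^+ 2 + x) * w).
Proof. by rewrite mulrDr -exprMn mulrDl !trD tr_sqr addrC. Qed.

Lemma artin_schreier_neq0 (x : K) : (x ^+ 2 + x != 0) = (x \notin [:: 0; 1]).
Proof.
have := artin_schreier_eq x 0; rewrite expr0n !add0r => ->.
by rewrite !inE.
Qed.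

(* dform is an alternating form in u, v, so it may be evaluated on any basis of
   the plane they span; one can be chosen with tr u = 0. *)
Lemma dform_tr : (forall u v : K, u != 0 -> dform u v = 0 -> v = 0 \/ v = u) <->
  (forall x : K, x \notin [:: 0; 1] ->
     tr (L (x ^+ 2 + x) / (x ^+ 2 + x) ^+ 3) = 0 ->
     tr (x ^+ 2 * L (x ^+ 2 + x) / (x ^+ 2 + x) ^+ 3) = 0).
Proof.
split=> [inj x | H].
  rewrite -artin_schreier_neq0 -mulrA; move: (tr_artin_schreier x) => tr_u u_neq0.
  case/tr_eq0_artin_schreier=> w Dw; rewrite Dw tr_artin_schreierM.
  move: tr_u u_neq0 Dw; set u := x ^+ 2 + x => tr_u u_neq0 Dw.
  case: (F2_cases (tr (u * w))) => // tr_v.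
  (* The zero [u * w] has trace 1, whereas [0] and [u] have trace 0. *)
  have /eqP/(inj _ _ u_neq0) : dform u (u * w) == 0.
    by rewrite dform_root // Dw [u * w]mulrC mulfK.
  by case=> e; move: tr_v; rewrite e ?tr0 ?tr_u.
have no_root u v : u != 0 -> tr u = 0 -> tr v = 1 -> dform u v <> 0.
  move=> u_neq0 tr_u tr_v /eqP; rewrite dform_root // => /eqP Dw.
  have [x Du] := tr_eq0_artin_schreier _ tr_u.
  move: (H x); rewrite -artin_schreier_neq0 -mulrA -Du Dw tr_artin_schreier.
  move/(_ u_neq0 erefl).
  by rewrite tr_artin_schreierM -Du mulrC divfK // tr_v.
move=> u v u_neq0 uv0; case: (v =P 0) => [-> | /eqP v_neq0]; first by left.
right; case: (F2_cases (tr u)) (F2_cases (tr v)) => [tr_u | tr_u] [tr_v | tr_v].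
(* When both traces vanish, [L] drops out and only the polarization of the cube remains. *)
- move: uv0; rewrite /dform tr_u tr_v !scale0r !mul0r !addr0.
  have -> : u * v ^+ 2 + u ^+ 2 * v = u * v * (u + v) by ring.
  move/eqP; rewrite !mulf_eq0 (negPf u_neq0) (negPf v_neq0) /= => /eqP.
  exact: addr_eq0_pchar2.
- by case: (no_root u v).
- by case: (no_root v u) => //; rewrite dformC.
(* When both traces are 1, [u + v] has trace 0 and can replace [u]. *)
- case: (u + v =P 0) => [/addr_eq0_pchar2 // | /eqP uv_neq0].
  case: (no_root (u + v) v) => //; last by rewrite dformDl.
  by rewrite trD tr_u tr_v (addrr_pchar2 (pchar_Fp _)).
Qed.

End Derivative.

End Trace.

(** * Signs and the character sums *)

Lemma signD_F2 (j k : 'F_2) : (-1) ^+ (j + k)%R = (-1) ^+ j * (-1) ^+ k :> rat.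
Proof.
by case: (F2_cases j) => ->; case: (F2_cases k) => ->;
  rewrite ?add0r ?addr0 ?(addrr_pchar2 (pchar_Fp _)) ?mul1r ?mulr1 //= mulrNN mulr1.
Qed.

(** The left-hand side is [1 / 2] except at [j = 1], [k = 0], where it is [- 3 / 2]. *)
Lemma sign_F2_leif (j k : 'F_2) :
  ((-1) ^+ j + (-1) ^+ (j + k)%R - (-1) ^+ k) / 2 <= 1 / 2
    ?= iff ((k == 0) ==> (j == 0)) :> rat.
Proof.
by rewrite signD_F2; case: (F2_cases j) => ->; case: (F2_cases k) => ->; split.
Qed.

Theorem theorem4 (n : nat) (F : finFieldType) (charF : 2%N \in [pchar F])
    (cardF : #|F| = (2 ^ n)%N)
    (L : {linear pPrimeCharType charF -> pPrimeCharType charF})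
    (G : pPrimeCharType charF -> pPrimeCharType charF)
    (defG : forall x, G x = x ^+ 3 + tr x *: L x) :
  APN G <->
  \sum_(x : pPrimeCharType charF | x \notin [:: 0; 1])
      (-1) ^+ tr (x ^+ 2 * L (x ^+ 2 + x) / (x ^+ 2 + x) ^+ 3)
  - 1 / 2 * \sum_(x : pPrimeCharType charF | x \notin [:: 0; 1])
      (-1) ^+ tr (L (x ^+ 2 + x) / (x ^+ 2 + x) ^+ 3)
  = 2 ^+ (n - 1) - 1 :> rat.
Proof.
pose K := pPrimeCharType charF.
pose a (x : K) := tr (x ^+ 2 * L (x ^+ 2 + x) / (x ^+ 2 + x) ^+ 3).
pose b (x : K) := tr (L (x ^+ 2 + x) / (x ^+ 2 + x) ^+ 3).
pose P := [pred x : K | x \notin [:: 0; 1]].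
rewrite (APN_dform _ _ _ _ defG) (dform_tr _ _ _ cardF L).
rewrite -[X in X - _]/(\sum_(x | P x) (-1) ^+ a x).
rewrite -[X in _ * X]/(\sum_(x | P x) (-1) ^+ b x).
have u1 (x : K) : (x + 1) ^+ 2 + (x + 1) = x ^+ 2 + x.
  by apply: (eq_pchar2 _ charF (x + 1)); ring.
have aD1 x : a (x + 1) = a x + b x.
  rewrite /a /b u1 -trD; congr (tr _).
  by apply: (eq_pchar2 _ charF (x * L (x ^+ 2 + x) / (x ^+ 2 + x) ^+ 3)); ring.
(* The translation [x + 1] permutes the index set, because it preserves [x ^+ 2 + x]. *)
have suma : \sum_(x | P x) (-1) ^+ a x = \sum_(x | P x) (-1) ^+ (a x + b x)%R :> rat.
  rewrite (reindex_inj (addIr 1)) /=; apply: eq_big => [x | x _]; last by rewrite aD1.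
  by rewrite -!artin_schreier_neq0 u1.
have -> : \sum_(x | P x) (-1) ^+ a x - 1 / 2 * \sum_(x | P x) (-1) ^+ b x
    = \sum_(x | P x) ((-1) ^+ a x + (-1) ^+ (a x + b x)%R - (-1) ^+ b x) / 2 :> rat.
  by rewrite -mulr_suml sumrB big_split /= -suma; field.
have -> : 2 ^+ (n - 1) - 1 = \sum_(x | P x) (1 / 2) :> rat.
  rewrite sumr_const.
  have /eqP : (2 + #|P|)%N = (2 ^ n)%N.
    by rewrite -cardF -(cardC (mem [:: 0 : K; 1])) (card_uniqP _) //= inE eq_sym oner_eq0.
  (* For [n = 0] the equation reads [2 + #|P| = 1], which is absurd; hence [n - 1] is not
     truncated. *)
  case: n cardF => [|m] _; first by [].
  rewrite subn1 /= -(eqr_nat rat) natrD natrX exprS => /eqP e.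
  by rewrite -mulr_natr; lra.
(* Equality of the sums forces equality in every termwise bound. *)
have := @leif_sum rat K P _ _ _ (fun x _ => sign_F2_leif (a x) (b x)).
case=> _ eqsum; split=> [H | /eqP].
  apply/eqP; rewrite eqsum; apply/forall_inP => x Px; apply/implyP => /eqP bx.
  by apply/eqP/H.
rewrite eqsum => /forall_inP H x Px bx.
by apply/eqP/(implyP (H x Px)); apply/eqP.
Qed.
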